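(* Let $t^*\in\mathcal{S}^0$ and let $x^*\in\arg\min_{x\in\mathcal{X}}\phi(x,t^* )$. Then $t^*$ is a global optimal solution of problem (EP) if and only if $(x^*,t^* )$ is a global optimal solution of problem (P$_1$). Moreover, the global optimal values of (P$_1$) and (EP) are equal.
   Context: Setting. $p\ge 2$, $A\in\mathbb{R}^{m\times n}$, $b\in\mathbb{R}^m$, $\mathcal{X}=\{x\in\mathbb{R}^n : Ax\le b\}$ is nonempty, bounded and $n$-dimensional; $c_j\in\mathbb{R}^n$, $d_j\in\mathbb{R}$, $\alpha_j\in\mathbb{R}\setminus\{0\}$ and $\min_{x\in\mathcal{X}}(c_j^\top x+d_j)>0$ for $j=1,\dots,p$. The indices are ordered so that $\alpha_j>0$ for $j\in J^+=\{1,\dots,\bar p\}$ and $\alpha_j<0$ for $j\in J^-=\{\bar p+1,\dots,p\}$, where $1\le\bar p\le p$. For $j\in J^+$ let $$\underline t_j=\frac{1}{\max_{x\in\mathcal{X}}(c_j^\top x+d_j)}>0,\qquad \overline t_j=\frac{1}{\min_{x\in\mathcal{X}}(c_j^\top x+d_j)}.$$ Let $\mathcal{S}^0\subset\mathbb{R}^{\bar p}$ be the simplex (convex hull) with vertices $v^{0,1}=(\underline t_1,\dots,\underline t_{\bar p})^\top$ and $v^{0,j+1}=v^{0,1}+\bar p(\overline t_j-\underline t_j)e_j$, $j=1,\dots,\bar p$, where $e_j$ is the $j$-th standard basis vector. Problem (P$_1$): minimize $$\phi(x,t)=\sum_{j\in J^-}\alpha_j\ln(c_j^\top x+d_j)+\sum_{j\in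 J^+}\alpha_j\bigl(t_j(c_j^\top x+d_j)-\ln t_j-1\bigr)$$ subject to $x\in\mathcal{X}$, $t\in\mathcal{S}^0$. Problem (EP): minimize $\psi(t)$ subject to $t\in\mathcal{S}^0$, where $\psi(t)=\min_{x\in\mathcal{X}}\phi(x,t)$. *)

(* Defs.v *)
From mathcomp Require Import all_boot all_order all_algebra.
From mathcomp Require Import all_classical all_reals all_analysis.

Set Implicit Arguments.
Unset Strict Implicit.
Unset Printing Implicit Defensive.

Import Order.TTheory GRing.Theory Num.Theory.
Import numFieldNormedType.Exports.

Local Open Scope classical_set_scope.
Local Open Scope ring_scope.

Section Extrema.
Variable R : realType.

(* In the style of [supremums] and [infimums]: the set of minima (maxima) of
   [S] has at most one element, and is empty iff [S] has no least (greatest)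
   element.  [minimum] and [maximum] return 0 in that case. *)
Definition minimums (S : set R) : set R := S `&` lbound S.
Definition maximums (S : set R) : set R := S `&` ubound S.
Definition minimum (S : set R) : R := xget 0 (minimums S).
Definition maximum (S : set R) : R := xget 0 (maximums S).

Lemma minimumE (S : set R) (v : R) : minimums S v -> minimum S = v.
Proof.
move=> Sv; apply: xget_unique => // w [Sw lw].
by apply/eqP; rewrite eq_le (lw _ Sv.1) (Sv.2 _ Sw).
Qed.

Lemma maximumE (S : set R) (v : R) : maximums S v -> maximum S = v.
Proof.
move=> Sv; apply: xget_unique => // w [Sw uw].
by apply/eqP; rewrite eq_le (Sv.2 _ Sw) (uw _ Sv.1).
Qed.

Definition argmin (T : Type) (D : set T) (f : T -> R) : set T :=
  [set x | D x /\ forall y, D y -> f x <= f y].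

End Extrema.

Section Geometry.
Variable R : realType.

Definition polyhedron (m n : nat) (A : 'M[R]_(m, n)) (b : 'cV[R]_m) :
  set 'cV[R]_n := [set x | forall i, (A *m x) i 0 <= b i 0].

Definition affinely_independent (k n : nat) (x : 'I_k -> 'cV[R]_n) : Prop :=
  forall w : 'I_k -> R,
    \sum_i w i = 0 -> \sum_i w i *: x i = 0 -> forall i, w i = 0.

(* The affine hull of a subset of R^n has dimension n iff the subset contains
   n + 1 affinely independent points. *)
Definition full_dimensional (n : nat) (X : set 'cV[R]_n) : Prop :=
  exists x : 'I_n.+1 -> 'cV[R]_n,
    (forall i, X (x i)) /\ affinely_independent x.

Definition convex_hull (k n : nat) (v : 'I_k -> 'cV[R]_n) : set 'cV[R]_n :=
  [set \sum_i w i *: v i | w in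
    [set w : 'I_k -> R | (forall i, 0 <= w i) /\ \sum_i w i = 1]].

End Geometry.

Section Problems.
Variables (R : realType) (n p pbar : nat).

(* J^+ is 'I_pbar, embedded in 'I_p by [widen_ord]; J^- is the set of the
   j : 'I_p such that pbar <= j. *)
Variable le_pbar_p : (pbar <= p)%N.
Variable X : set 'cV[R]_n.
Variables (c : 'I_p -> 'cV[R]_n) (d alpha : 'I_p -> R).

Definition affine (j : 'I_p) (x : 'cV[R]_n) : R := ((c j)^T *m x) 0 0 + d j.

Local Notation pos := (widen_ord le_pbar_p).

Definition t_lower (j : 'I_pbar) : R := 1 / maximum (affine (pos j) @` X).
Definition t_upper (j : 'I_pbar) : R := 1 / minimum (affine (pos j) @` X).

(* The vertex of index 0 is v^{0,1}, the one of index [lift ord0 j] is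
   v^{0,j+1}. *)
Definition vertex (k : 'I_pbar.+1) : 'cV[R]_pbar :=
  let v1 := \col_j t_lower j in
  if unlift ord0 k is Some j
  then v1 + (pbar%:R * (t_upper j - t_lower j)) *: delta_mx j 0
  else v1.

Definition simplex0 : set 'cV[R]_pbar := convex_hull vertex.

Definition phi (x : 'cV[R]_n) (t : 'cV[R]_pbar) : R :=
  \sum_(j < p | (pbar <= j)%N) alpha j * ln (affine j x) +
  \sum_(j < pbar)
    alpha (pos j) * (t j 0 * affine (pos j) x - ln (t j 0) - 1).

Definition psi (t : 'cV[R]_pbar) : R := minimum (phi^~ t @` X).

Definition P1_feasible : set ('cV[R]_n * 'cV[R]_pbar) := X `*` simplex0.
Definition P1_objective (z : 'cV[R]_n * 'cV[R]_pbar) : R := phi z.1 z.2.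

Definition P1_solutions := argmin P1_feasible P1_objective.
Definition EP_solutions := argmin simplex0 psi.

Definition P1_optimal_values : set R := minimums (P1_objective @` P1_feasible).
Definition EP_optimal_values : set R := minimums (psi @` simplex0).

End Problems.

(* Main.v *)
Require Import Defs.
From mathcomp Require Import all_boot all_order all_algebra.
From mathcomp Require Import all_classical all_reals all_analysis.
Import Order.TTheory GRing.Theory Num.Theory.
Import numFieldNormedType.Exports.
Local Open Scope classical_set_scope.
Local Open Scope ring_scope.

(* If x minimizes [phi^~ t], then [psi t = phi x t], and [psi t <= phi y t] for
   all y in X; hence minimizing [psi] and minimizing [phi] jointly amount to the
   same thing, provided that all minima are attained.  They are: X is closed and
   bounded, the simplex is a continuous image of the standard simplex, and [phi]
   is continuous on their product because the arguments of the logarithms are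
   positive there. *)

(** * Minimizing out one of two variables *)

Section PartialMinimization.
Context {R : realType} {T U : Type}.
Variables (X : set T) (S : set U) (f : T -> U -> R).

Lemma argmin_minimums {V : Type} {D : set V} {g : V -> R} {x : V} :
  argmin D g x -> minimums (g @` D) (g x).
Proof.
move=> [Dx minx]; split; first by exists x.
by move=> _ [y Dy <-]; exact: minx.
Qed.

Lemma minimum_argmin {V : Type} {D : set V} {g : V -> R} {x : V} :
  argmin D g x -> minimum (g @` D) = g x.
Proof. by move=> /argmin_minimums; exact: minimumE. Qed.

Let h (t : U) : R := minimum (f^~ t @` X).

Hypothesis attained : forall t, S t -> exists x, argmin X (f^~ t) x.

(** This rests on attainment: where no minimum exists, [h t] is the default value 0 and bounds
    nothing. *)
Lemma le_partial_minimum {t x} : S t -> X x -> h t <= f x t.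
Proof.
move=> /attained[y ymin] Xx; rewrite /h (minimum_argmin ymin).
exact: ymin.2.
Qed.

(** Both objectives take the value [h t = f x t] at the given points. If [t] minimizes [h], then
    [f x t = h t <= h s <= f y s]. Conversely, a minimizer [y] for [s] gives
    [f x t <= f y s = h s]. *)
Lemma argmin_partial_minimum {t x} : S t -> argmin X (f^~ t) x ->
  argmin S h t <-> argmin (X `*` S) (fun z => f z.1 z.2) (x, t).
Proof.
move=> St xmin; have hE : h t = f x t := minimum_argmin xmin.
split=> -[_ tmin].
- split; first by split; [exact: xmin.1|].
  move=> [y s] [/= Xy Ss]; rewrite -hE.
  exact: le_trans (tmin s Ss) (le_partial_minimum Ss Xy).
- split=> // s Ss; have [y ymin] := attained s Ss.
  rewrite hE {1}/h (minimum_argmin ymin).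
  by apply: (tmin (y, s)); split => //=; exact: ymin.1.
Qed.

End PartialMinimization.

(** Positivity rules out the default value 0, so the minimum is a genuine one. *)
Lemma minimum_gt0_lbound {R : realType} {S : set R} :
  0 < minimum S -> lbound S (minimum S).
Proof.
have [[v Sv] _|S0] := pselect (exists v, minimums S v).
  by rewrite (minimumE Sv); exact: Sv.2.
by rewrite /minimum xgetPN ?ltxx// => v Sv; apply: S0; exists v.
Qed.

(** * Compactness of polyhedra and convex hulls, and attainment of minima *)

Section MatrixCompactness.
Context {R : realType}.

Lemma trmx_continuous m n : continuous (@trmx R m n).
Proof.
move=> u A /nbhs_ballP[e /= e0 eA].
apply/nbhs_ballP; exists e => //= v [_ uv]; apply: eA; split => // i j.
by rewrite !mxE; exact: uv.
Qed.

(** Heine-Borel, carried over from row vectors by transposition, which permutes the entries and so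
    preserves the max norm. *)
Lemma bounded_closed_compact_cV n (A : set 'cV[R]_n) :
  bounded_set A -> closed A -> compact A.
Proof.
move=> [M [Mreal AM]] Acl.
have -> : A = trmx @` (trmx @^-1` A : set 'rV[R]_n).
  apply/seteqP; split=> [x Ax|_ [y Ay <-]//].
  by exists x^T; rewrite /= trmxK.
apply: continuous_compact.
  by apply: continuous_subspaceT => x; exact: trmx_continuous.
apply: bounded_closed_compact.
  exists M; split=> // N MN y /= Ay; apply: le_trans (AM _ MN _ Ay).
  rewrite [leLHS]/Num.norm [leRHS]/Num.norm /= !mx_normrE.
  apply: bigmax_le => [|[i j] _ /=].
    by apply/bigmax_geP; left.
  by apply/bigmax_geP; right; exists (j, i) => //=; rewrite mxE.
by apply: preimage_closed Acl => x _; exact: trmx_continuous.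
Qed.

Lemma mulmx_coord_continuous m n (B : 'M[R]_(m, n)) i :
  continuous (fun x : 'cV[R]_n => (B *m x) i 0).
Proof.
under eq_fun do rewrite mxE.
apply: continuous_big => [|j _ x]; first exact: add_continuous.
by apply: continuousM; [exact: cst_continuous|exact: coord_continuous].
Qed.

Lemma polyhedron_closed m n (A : 'M[R]_(m, n)) (b : 'cV[R]_m) :
  closed (polyhedron A b).
Proof.
have -> : polyhedron A b =
    \bigcap_i (fun x : 'cV[R]_n => (A *m x) i 0) @^-1` [set r | r <= b i 0].
  by apply/seteqP; split=> [x Ax i _|x Ax i]; exact: Ax.
apply: closed_bigI => i _; apply: preimage_closed (@closed_le _ _).
by move=> x _; exact: mulmx_coord_continuous.
Qed.

Lemma convex_hull_compact k n (v : 'I_k -> 'cV[R]_n) : compact (convex_hull v).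
Proof.
(* Weights become row vectors so that the standard simplex [W] lives in a matrix topology; it is
   compact as a closed subset of the unit cube. *)
pose W := [set w : 'rV[R]_k | (forall i, 0 <= w 0 i) /\ \sum_i w 0 i = 1].
have -> : convex_hull v = (fun w : 'rV[R]_k => \sum_i w 0 i *: v i) @` W.
  apply/seteqP; split=> _ [w [w0 w1] <-].
  - exists (\row_i w i); last by apply: eq_bigr => i _; rewrite mxE.
    by split=> [i|]; [rewrite mxE|under eq_bigr do rewrite mxE].
  - by exists (w 0).
apply: continuous_compact.
  apply: continuous_subspaceT; apply: continuous_big.
    exact: add_continuous.
  by move=> i _ w; apply: continuousZr_tmp; exact: coord_continuous.
have cube : compact [set w : 'rV[R]_k | forall i, w ord0 i \in `[0, 1]%R].
  apply: (@rV_compact _ _ (fun=> `[0 : R, 1]%classic)) => _.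
  exact: segment_compact.
apply: subclosed_compact _ cube _.
- have -> : W = \bigcap_i (fun w : 'rV[R]_k => w 0 i) @^-1` [set r | 0 <= r]
      `&` (fun w : 'rV[R]_k => \sum_i w 0 i) @^-1` [set 1].
    apply/seteqP; split=> w [w0 w1]; split=> // i; last exact: w0.
    by move=> _; exact: w0.
  apply: closedI.
    apply: closed_bigI => i _; apply: preimage_closed (@closed_ge _ _).
    by move=> w _; exact: coord_continuous.
  apply: preimage_closed (@closed_eq _ _) => w _.
  apply: continuous_big => [|i _]; first exact: add_continuous.
  exact: coord_continuous.
(* A weight is at most 1 because the remaining ones are nonnegative and the total is 1. *)
- move=> w [w0 w1] i; rewrite in_itv/= w0 -w1 (bigD1 i)//= lerDl.
  exact: sumr_ge0.
Qed.

(** Continuity is asked only at the points of [D], since that of [phi] is established only where the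
    arguments of [ln] are positive. *)
Lemma compact_argmin {T : topologicalType} (D : set T) (g : T -> R) :
  D !=set0 -> compact D -> {in D, continuous g} -> exists x, argmin D g x.
Proof.
move=> D0 Dc /continuous_in_subspaceT gc.
have [x xD xmin] := compact_EVT_min D0 Dc gc.
exists x; split; first exact: set_mem.
by move=> y Dy; apply: xmin; exact: mem_set.
Qed.

End MatrixCompactness.

(** * Continuity of the objective and positivity of the arguments of its logarithms *)

Section Objective.
Context {R : realType} {n p pbar : nat} (le_pbar_p : (pbar <= p)%N).
Variables (c : 'I_p -> 'cV[R]_n) (d alpha : 'I_p -> R).

Lemma affine_continuous j : continuous (affine c d j).
Proof.
move=> x; apply: continuousD; last exact: cst_continuous.
exact: mulmx_coord_continuous.
Qed.

Lemma phi_continuous_at (z : 'cV[R]_n * 'cV[R]_pbar) :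
  (forall j, 0 < affine c d j z.1) -> (forall j, 0 < z.2 j 0) ->
  {for z, continuous (P1_objective le_pbar_p c d alpha)}.
Proof.
move=> x0 t0.
have affine_fst j : {for z, continuous (affine c d j \o fst)}.
  by apply: continuous_comp; [exact: cvg_fst|exact: affine_continuous].
have coord_snd (j : 'I_pbar) :
    {for z, continuous (fun y : 'cV[R]_n * 'cV[R]_pbar => y.2 j 0)}.
  apply: (@continuous_comp _ _ _ snd (fun t : 'cV[R]_pbar => t j 0)).
    exact: cvg_snd.
  exact: coord_continuous.
have neg_term j :
    {for z, continuous (fun y => alpha j * ln (affine c d j y.1))}.
  apply: continuousM; first exact: cst_continuous.
  apply: (continuous_comp (affine_fst j)).
  by apply: continuous_ln => /=.
(* The index [i] is kept free of [j]; it is later instantiated with the embedding of [j] in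
   ['I_p]. *)
have pos_term (j : 'I_pbar) (i : 'I_p) : {for z, continuous (
    fun y : 'cV[R]_n * 'cV[R]_pbar =>
    alpha i * (y.2 j 0 * affine c d i y.1 - ln (y.2 j 0) - 1))}.
  apply: continuousM; first exact: cst_continuous.
  apply: continuousB; last exact: cst_continuous.
  apply: continuousB.
    by apply: continuousM; [exact: coord_snd|exact: affine_fst].
  apply: (continuous_comp (coord_snd j)).
  by apply: continuous_ln => /=.
apply: continuousD; apply: cvg_big => [|j _]; try exact: add_continuous.
  exact: neg_term.
exact: pos_term.
Qed.

Variable X : set 'cV[R]_n.
Hypothesis X0 : X !=set0.
Hypothesis X_compact : compact X.
Hypothesis min_affine_gt0 : forall j, 0 < minimum (affine c d j @` X).

Lemma affine_gt0 j x : X x -> 0 < affine c d j x.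
Proof.
move=> Xx; apply: lt_le_trans (min_affine_gt0 j) _.
by apply: minimum_gt0_lbound => //; exists x.
Qed.

(** All vertices have positive coordinates, and positivity survives convex combination. *)
Lemma simplex0_gt0 t : simplex0 le_pbar_p X c d t -> forall j, 0 < t j 0.
Proof.
move=> [w [w0 w1] <-] j; set i := widen_ord le_pbar_p j.
have fX0 : affine c d i @` X !=set0 by exact: image_nonempty.
(* Compactness shows that the maximum is attained; with the default value 0 of [maximum], [t_lower]
   would be 1 / 0 = 0. *)
have [x [Xx xmax]] : exists x, argmin X (- affine c d i) x.
  apply: compact_argmin => // x _.
  by apply: continuousN; exact: affine_continuous.
have maxE : maximum (affine c d i @` X) = affine c d i x.
  apply: maximumE; split; first by exists x.
  by move=> _ [y Xy <-]; have := xmax y Xy; rewrite lerN2.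
have lower_gt0 : 0 < t_lower le_pbar_p X c d j.
  by rewrite /t_lower maxE div1r invr_gt0 affine_gt0.
have le_lower_upper : t_lower le_pbar_p X c d j <= t_upper le_pbar_p X c d j.
  rewrite /t_lower /t_upper maxE !div1r lef_pV2 ?posrE ?affine_gt0//.
  by apply: minimum_gt0_lbound => //; exists x.
have vertex_gt0 k : 0 < vertex le_pbar_p X c d k j 0.
  rewrite /vertex; case: unliftP => [l _|_]; rewrite !mxE//.
  rewrite ltr_pwDl//; case: eqVneq => [<-|_]; last by rewrite mulr0.
  by rewrite eqxx mulr1 mulr_ge0// subr_ge0.
rewrite summxE; under eq_bigr do rewrite mxE.
(* The coordinate is a sum of nonnegative terms. Were it 0, every term would vanish, hence every
   weight, although the weights sum to 1. *)
rewrite lt_neqAle sumr_ge0 ?andbT => [|k _]; last first.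
  by rewrite mulr_ge0 ?w0 ?ltW.
apply/negP; rewrite eq_sym psumr_eq0 => [/allP wv0|k _]; last first.
  by rewrite mulr_ge0 ?w0 ?ltW.
have /eqP := w1; rewrite big1 => [|k _]; first by rewrite eq_sym oner_eq0.
have /eqP/eqP := wv0 k (mem_index_enum k).
by rewrite mulf_eq0 (gt_eqF (vertex_gt0 k)) orbF => /eqP.
Qed.

Lemma simplex0_nonempty : simplex0 le_pbar_p X c d !=set0.
Proof.
(* The witness is the vertex of index 0, with all the weight on it. *)
exists (\sum_k (k == ord0)%:R *: vertex le_pbar_p X c d k).
exists (fun k => (k == ord0)%:R) => //; split=> [k|]; first exact: ler0n.
by rewrite (bigD1 ord0)//= big1 ?addr0// => k /negbTE ->.
Qed.

(** [S] is arbitrary because two cases are used: a singleton for the inner minimization over [X],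
    and the whole simplex for the joint problem. *)
Lemma phi_attained (S : set 'cV[R]_pbar) :
  S !=set0 -> compact S -> (forall t, S t -> forall j, 0 < t j 0) ->
  exists z, argmin (X `*` S) (P1_objective le_pbar_p c d alpha) z.
Proof.
move=> [t St] S_compact S_gt0; have [x Xx] := X0.
apply: compact_argmin; [by exists (x, t)|exact: compact_setX|].
move=> z /set_mem[Xz Sz]; apply: phi_continuous_at; last exact: S_gt0.
by move=> j; exact: affine_gt0.
Qed.

End Objective.

Theorem theorem2p2 (R : realType) (m n p pbar : nat)
    (A : 'M[R]_(m, n)) (b : 'cV[R]_m)
    (c : 'I_p -> 'cV[R]_n) (d alpha : 'I_p -> R)
    (p_ge2 : (2 <= p)%N)
    (pbar_ge1 : (1 <= pbar)%N)
    (le_pbar_p : (pbar <= p)%N)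
    (X_nonempty : polyhedron A b !=set0)
    (X_bounded : bounded_set (polyhedron A b))
    (X_full_dim : full_dimensional (polyhedron A b))
    (min_affine_gt0 : forall j : 'I_p,
       0 < minimum (affine c d j @` polyhedron A b))
    (alpha_pos : forall j : 'I_p, (j < pbar)%N -> 0 < alpha j)
    (alpha_neg : forall j : 'I_p, (pbar <= j)%N -> alpha j < 0) :
  let X := polyhedron A b in
  let S0 := simplex0 le_pbar_p X c d in
  (forall (tstar : 'cV[R]_pbar) (xstar : 'cV[R]_n),
     S0 tstar ->
     argmin X (fun x => phi le_pbar_p c d alpha x tstar) xstar ->
     EP_solutions le_pbar_p X c d alpha tstar <->
     P1_solutions le_pbar_p X c d alpha (xstar, tstar)) /\
  (exists v : R,
     P1_optimal_values le_pbar_p X c d alpha v /\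
     EP_optimal_values le_pbar_p X c d alpha v).
Proof.
move=> X S0.
have X_compact : compact X.
  by apply: bounded_closed_compact_cV => //; exact: polyhedron_closed.
have S0_gt0 : forall t, S0 t -> forall j, 0 < t j 0.
  by move=> t; exact: simplex0_gt0.
have attained t : S0 t ->
    exists x, argmin X ((phi le_pbar_p c d alpha)^~ t) x.
  move=> St.
  (* Minimizing over [X] with [t] fixed is minimizing jointly over [X] times [[set t]]. *)
  have [| |s ->|[x s] [[/= Xx ->] xmin]] :=
    @phi_attained R n p pbar le_pbar_p c d alpha X X_nonempty X_compact
      min_affine_gt0 [set t].
  - by exists t.
  - exact: compact_set1.
  - exact: S0_gt0.
  - by exists x; split=> // y Xy; exact: (xmin (y, t)).
have equiv t x : S0 t -> argmin X ((phi le_pbar_p c d alpha)^~ t) x ->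
    EP_solutions le_pbar_p X c d alpha t <->
    P1_solutions le_pbar_p X c d alpha (x, t).
  by move=> St; exact: (argmin_partial_minimum _ _ _ attained St).
split=> [t x St xmin|]; first exact: equiv.
have [||[x t] ztmin] := @phi_attained R n p pbar le_pbar_p c d alpha X
  X_nonempty X_compact min_affine_gt0 S0 _ _ S0_gt0.
- exact: simplex0_nonempty.
- exact: convex_hull_compact.
have [[/= Xx St] zmin] := ztmin.
(* A joint minimizer is in particular optimal in [x] for its own [t], so [equiv] applies to it. *)
have xmin : argmin X ((phi le_pbar_p c d alpha)^~ t) x.
  by split=> // y Xy; exact: (zmin (y, t)).
exists (phi le_pbar_p c d alpha x t); split.
  exact: argmin_minimums ztmin.
(* Thus [t] solves (EP), with optimal value [psi t = phi x t]. *)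
have /argmin_minimums := (equiv t x St xmin).2 ztmin.
by rewrite {2}/psi (minimum_argmin xmin).
Qed.
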